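(* Let $\mathcal{G}$ be a generalised quadrangle of order $(s,s^2)$ and let $\infty=P^\perp$ where $P$ is a point of $\mathcal{G}$. Let $\mathcal{I}$ be an intriguing set of $\mathcal{G}$ with parameters $(h_1,h_2)$ which is intriguing at infinity (with respect to $\infty$) with parameters $(a_1,a_2)$, where $\mathcal{I}\setminus\infty$ is a nonempty proper subset of the point set of $\mathcal{G}\setminus\infty$. Then $\mathcal{I}\setminus\infty$ is an intriguing set of the partial quadrangle $\mathcal{G}\setminus\infty$ of the same parity as $\mathcal{I}$ (positive if $\mathcal{I}$ is positive, negative if $\mathcal{I}$ is negative), and the following hold: (1) if $\mathcal{I}$ is an $m$-ovoid and $P\notin\mathcal{I}$, then $a_1=m(s+1)-s$, $a_2=m(s+1)$ and $|\mathcal{I}\cap P^\perp|=m(s^2+1)$; (2) if $\mathcal{I}$ is an $m$-ovoid and $P\in\mathcal{I}$, then $a_1=m(s+1)-2s$, $a_2=m(s+1)-s$ and $|\mathcal{I}\cap P^\perp|=m(s^2+1)-s^2$; (3) if $\mathcal{I}$ is an $i$-tight set and $P\notin\mathcal{I}$, then $a_1=a_2=i/s$ and $|\mathcal{I}\cap P^\perp|=i$; (4) if $\mathcal{I}$ is an $i$-tight set and $P\in\mathcal{I}$, then $a_1=a_2=(i-1)/s+1$ and $|\mathcal{I}\cap P^\perp|=i+s$.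
   Context: A generalised quadrangle of order $(s,t)$ is a point-line incidence structure in which two distinct points are on at most one line, every line has $s+1$ points, every point is on $t+1$ lines, and for every point $X$ not on a line $\ell$ there is exactly one point of $\ell$ collinear with $X$; here $s\ge2$. $X^\perp$ is the set of all points collinear with $X$, including $X$. For a point $P$ of a generalised quadrangle $\mathcal{G}$ of order $(s,s^2)$, $\mathcal{G}\setminus P^\perp$ denotes the geometry whose points are the points of $\mathcal{G}$ not collinear with $P$ and whose lines are the lines of $\mathcal{G}$ not through $P$. It is a partial quadrangle $\mathsf{PQ}(s-1,s^2,s(s-1))$: lines have $s$ points, points are on $s^2+1$ lines, for each non-incident point-line pair at most one point of the line is collinear with the point, and two non-collinear points have exactly $s(s-1)$ points collinear with both. Its point graph is strongly regular with valency $(s-1)(s^2+1)$ and other eigenvalues $s-1$ and $-s^2+s-1$. The point graph of $\mathcal{G}$ has valency $s(s^2+1)$ and other eigenvalues $s-1$ and $-s^2-1$. A nonempty proper subset $\mathcal{I}$ of the points of a generalised or partial quadrangle is an intriguing set with parameters $(h_1,h_2)$ if the number of points of $\mathcal{I}$ collinear with and distinct from a point $X$ is $h_1$ if $X\in\mathcal{I}$ and $h_2$ if $X\notin\mathcal{I}$. It is positive (negative) if $h_1-h_2$ is the nonnegative (negative) eigenvalue, other than the valency, of the adjacency matrix of the point graph. For a generalised quadrangle of order $(s,t)$, the negative intriguing sets are exactly the (nontrivial) $m$-ovoids, i.e. sets of points meeting every line in exactly $m$ points ($h_1=m(t+1)-t-1$, $h_2=m(t+1)$), and the positive ones are exactly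 the (nontrivial) $i$-tight sets, i.e. those with $h_1=i+s-1$, $h_2=i$. A set of points $\mathcal{I}$ of $\mathcal{G}$ is intriguing at infinity (with respect to $\infty$) with parameters $(a_1,a_2)$ if $|y^\perp\cap\mathcal{I}\cap\infty|$ equals $a_1$ for every $y\in\mathcal{I}\setminus\infty$ and equals $a_2$ for every point $y\notin\mathcal{I}\cup\infty$. *)

(* Defs.v *)
From mathcomp Require Import all_boot all_order all_algebra.
Set Implicit Arguments.
Unset Strict Implicit.
Unset Printing Implicit Defensive.
Import Order.TTheory GRing.Theory Num.Theory.
Local Open Scope ring_scope.

(* Requiring finite carriers is no restriction here: a generalised quadrangle  *)
(* of order (s,t) with s, t natural numbers has finitely many points and lines. *)
Record geometry := Geometry {
  point : finType;
  line : finType;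
  inc : point -> line -> bool
}.

Section Geometry.
Variable G : geometry.
Implicit Types (x y : point G) (l : line G) (I : {set point G}).

Definition collinear x y : bool := [exists l, inc x l && inc y l].

Definition points_on l : {set point G} := [set x | inc x l].

Definition lines_on x : {set line G} := [set l | inc x l].

Definition perp x : {set point G} := x |: [set y | collinear x y].

Definition neighbours x : {set point G} := [set y | (y != x) && collinear x y].

Definition generalised_quadrangle (s t : nat) : Prop :=
  [/\ forall x y l l', x != y ->
        inc x l -> inc y l -> inc x l' -> inc y l' -> l = l',
      forall l, #|points_on l| = s.+1,
      forall x, #|lines_on x| = t.+1
    & forall x l, ~~ inc x l ->
        #|[set y in points_on l | collinear x y]| = 1%N].

(* The differences h1 - h2 compared with the eigenvalues below are integers,   *)
(* so it makes no difference whether they are eigenvalues over the rationals   *)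
(* or over the reals.                                                          *)
Definition adjacency_mx : 'M[rat]_#|point G| :=
  \matrix_(i, j) (enum_val j \in neighbours (enum_val i))%:R.

Definition nonvalency_eigenvalue (r : rat) : Prop :=
  eigenvalue adjacency_mx r /\
  exists k : nat, (forall x, #|neighbours x| = k) /\ r <> k%:R.

Definition intriguing I (h1 h2 : nat) : Prop :=
  [/\ I != set0, I != [set: point G],
      forall x, x \in I -> #|neighbours x :&: I| = h1
    & forall x, x \notin I -> #|neighbours x :&: I| = h2].

Definition positive_intriguing I : Prop :=
  exists h1 h2 : nat,
    [/\ intriguing I h1 h2, nonvalency_eigenvalue (h1%:R - h2%:R)
      & 0 <= h1%:R - h2%:R :> rat].

Definition negative_intriguing I : Prop :=
  exists h1 h2 : nat,
    [/\ intriguing I h1 h2, nonvalency_eigenvalue (h1%:R - h2%:R)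
      & h1%:R - h2%:R < 0 :> rat].

Definition ovoid (m : nat) I : Prop := forall l, #|points_on l :&: I| = m.

(* [s] is the first parameter of the order (s,t) of the quadrangle; it is      *)
(* positive, so the natural number subtraction is not truncated.               *)
Definition tight (s i : nat) I : Prop :=
  forall x, #|neighbours x :&: I| = (if x \in I then i + s - 1 else i)%N.

Definition intriguing_at_infinity (infty I : {set point G}) (a1 a2 : nat) : Prop :=
  (forall y, y \in I :\: infty -> #|perp y :&: I :&: infty| = a1) /\
  (forall y, y \notin I :|: infty -> #|perp y :&: I :&: infty| = a2).

End Geometry.

Definition remove_perp (G : geometry) (P : point G) : geometry :=
  @Geometry {x : point G | x \notin perp P} {l : line G | ~~ inc P l}
    (fun x l => inc (val x) (val l)).

Definition affine_part (G : geometry) (P : point G) (I : {set point G}) :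
    {set point (remove_perp P)} :=
  [set x : {x : point G | x \notin perp P} | val x \in I].

(* Main.v *)
Require Import Defs.
From mathcomp Require Import all_boot all_order all_algebra.
From mathcomp Require Import zify ring lra.
Set Implicit Arguments.
Unset Strict Implicit.
Unset Printing Implicit Defensive.
Import Order.TTheory GRing.Theory Num.Theory.
Local Open Scope ring_scope.

(** Call a point affine if it is not collinear with [P], write [N y] for the
    set of points distinct from and collinear with [y], and [T] for the part of
    [I] in [N P].  For an affine point [y] the number counted at infinity is
    a(y) = |N y & T|, the size of the trace of [y] on [I].  The neighbours of
    [y] in the partial quadrangle are those neighbours of [y] in the quadrangle
    that are affine, so removing [perp P] lowers both intersection numbers by
    the trace sizes: the affine part has parameters (h1 - a1, h2 - a2)
    ([intriguing_affine_part]).  What needs work is the value of a1 and a2.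

    Suppose first that [P] is not in [I].  In a quadrangle of order (s,t) two
    noncollinear points have t + 1 common neighbours, and for two points of
    [N P] exactly t of these are affine if the points are noncollinear and none
    is if they are collinear.  Hence the sum of a(y), over all affine points
    and over those in [I] only, and the sum of a(y)^2 are determined by [I] and
    by the number of collinear pairs in [T] ([affine_first_moment],
    [affine_moment_intriguing], [affine_second_moment]).

    - For a tight set, the number of collinear pairs is eliminated between the
      moment equations, and the two that remain say that a1 = a2 or a2 = 0.
      The case a2 = 0 is impossible for t = s^2: all affine neighbours of a
      point of [T] would then lie in [I], and these are too many.  So a1 = a2, and the first
      moment gives the common value ([tight_at_infinity]).
    - For an m-ovoid the number of collinear pairs is known and, as t = s^2,
      the deviations of a(y) from m(s+1) - s on [I], and from m(s+1) off [I],
      have sum of squares s^3 m (2m - s - 1) ([ovoid_deviation]).  Therefore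
      2m >= s + 1.  The same bound for the complementary (s+1-m)-ovoid and a
      point outside that one forces 2m = s + 1 ([ovoid_hemisystem]): every
      nontrivial m-ovoid is a hemisystem.  The sum of squares is then zero and
      every trace has the stated size ([ovoid_at_infinity]).

    If [P] is in [I], the same results are applied to the complement of [I],
    which does not contain [P].

    For the parity, counting walks of length two shows that h1 - h2 is s - 1 or
    -t - 1 for every intriguing set ([intriguing_difference]).  A positive
    intriguing set is thus tight, a1 = a2, and the difference s - 1 survives.
    For a negative one a1 - a2 >= -t - 1, and equality cannot occur
    ([negative_traces_not_extreme]), so the difference stays negative.  Finally,
    the difference of the parameters of an intriguing set of a regular graph is
    an eigenvalue as soon as it is not the valency ([intriguing_eigenvalue]). *)

Lemma exists_notin (T : finType) (A : {set T}) :
  A != setT -> exists x, x \notin A.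
Proof. by rewrite -subTset => /subsetPn[x _ xA]; exists x. Qed.

(** * Double counting with the collinearity relation *)

Section Neighbours.
Local Open Scope nat_scope.
Variable G : geometry.
Implicit Types (x y z : point G) (l : line G) (A B I : {set point G}).

Lemma collinearC x y : collinear x y = collinear y x.
Proof. by rewrite /collinear; apply: eq_existsb => l; rewrite andbC. Qed.

Lemma neighboursC x y : (y \in neighbours x) = (x \in neighbours y).
Proof. by rewrite !inE eq_sym collinearC. Qed.

Lemma perpE x : perp x = x |: neighbours x.
Proof. by apply/setP=> y; rewrite !inE; case: eqP. Qed.

Lemma exchange_neighbours A B (f : point G -> point G -> nat) :
  \sum_(y in A) \sum_(z in neighbours y :&: B) f y z =
  \sum_(z in B) \sum_(y in neighbours z :&: A) f y z.
Proof.
rewrite (exchange_big_dep (mem B)) /=; last by move=> y z _; case/setIP.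
apply: eq_bigr => z zB; apply: eq_bigl => y.
by rewrite in_setI zB andbT in_setI neighboursC andbC.
Qed.

Lemma sum_card_neighbours A B :
  \sum_(y in A) #|neighbours y :&: B| = \sum_(z in B) #|neighbours z :&: A|.
Proof.
under eq_bigr do rewrite -sum1_card.
by rewrite exchange_neighbours; under eq_bigr do rewrite sum1_card.
Qed.

(** The square of [#|neighbours y :&: B|] counts the ordered pairs of points of
    [B] that are both collinear with [y]. *)
Lemma sum_card_neighbours_sqr A B :
  \sum_(y in A) #|neighbours y :&: B| ^ 2 =
  \sum_(z in B) \sum_(w in B) #|neighbours z :&: neighbours w :&: A|.
Proof.
transitivity (\sum_(y in A) \sum_(z in neighbours y :&: B) #|neighbours y :&: B|).
  by apply: eq_bigr => y _; rewrite sum_nat_const -mulnn.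
rewrite exchange_neighbours; apply: eq_bigr => z _.
rewrite sum_card_neighbours; apply: eq_bigr => w _.
by rewrite setIA (setIC (neighbours w)).
Qed.

(** In a strongly regular graph a sum over [w] often depends only on whether [w]
    is [x], a neighbour of [x], or neither; this evaluates all such sums. *)
Lemma sum_by_distance x A (f : point G -> nat) u v r :
    f x = u -> (forall w, w \in A -> w \in neighbours x -> f w = v) ->
    (forall w, w \in A -> w \notin perp x -> f w = r) ->
  \sum_(w in A) f w =
    (x \in A) * u + #|neighbours x :&: A| * v + #|A :\: perp x| * r.
Proof.
move=> fx fN fD; rewrite (bigID (mem (perp x))) /=; congr (_ + _).
  rewrite (bigID (mem (neighbours x))) /= addnC; congr (_ + _).
    case: (boolP (x \in A)) => [xA|xA]; rewrite ?mul1n ?mul0n.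
      rewrite (big_pred1 x) // => w /=; rewrite perpE !inE /=.
      by case: eqP => [->|_]; rewrite ?xA ?eqxx //=; case: collinear; rewrite ?andbF.
    rewrite big1 // => w; rewrite perpE in_setU1 => /andP[/andP[wA]].
    by case/orP=> [/eqP wx|->] //; rewrite -wx wA in xA.
  rewrite -sum_nat_const; apply: eq_big => [w|w /andP[/andP[wA _]]]; last exact: fN.
  by rewrite perpE in_setU1 in_setI; case: (w \in neighbours x);
     rewrite ?andbF ?orbT ?andbT.
rewrite -sum_nat_const; apply: eq_big => [w|w /andP[]]; last exact: fD.
by rewrite in_setD andbC.
Qed.

Lemma card_by_distance x A :
  #|A| = (x \in A) + #|neighbours x :&: A| + #|A :\: perp x|.
Proof.
by rewrite -sum1_card (@sum_by_distance x A _ 1 1 1) // !muln1.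
Qed.

End Neighbours.

(** * Common neighbours in a generalised quadrangle *)

Section Quadrangle.
Local Open Scope nat_scope.
Variables (G : geometry) (s t : nat).
Hypothesis GQ : generalised_quadrangle G s t.
Implicit Types (x y z : point G) (l : line G) (A B I : {set point G}).

Lemma line_unique x y l l' :
  x != y -> inc x l -> inc y l -> inc x l' -> inc y l' -> l = l'.
Proof. by case: GQ => + _ _ _; apply. Qed.

Lemma collinear_point_unique x l y y' : ~~ inc x l ->
  inc y l -> inc y' l -> collinear x y -> collinear x y' -> y = y'.
Proof.
case: GQ => _ _ _ gq xl yl y'l xy xy'.
have /eqP/cards1P[w Ew] := gq x l xl.
have: y \in [set w] by rewrite -Ew !inE yl.
have: y' \in [set w] by rewrite -Ew !inE y'l.
by rewrite !inE => /eqP-> /eqP->.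
Qed.

Lemma collinear_point_exists x l :
  ~~ inc x l -> exists2 y, inc y l & y \in neighbours x.
Proof.
case: GQ => _ _ _ gq xl; have /eqP/cards1P[w Ew] := gq x l xl.
have: w \in [set w] by rewrite set11.
rewrite -Ew !inE => /andP[wl xw]; exists w => //; rewrite inE xw andbT.
by apply: contraNneq xl => <-.
Qed.

Lemma no_triangle x y z l : x != y -> inc x l -> inc y l ->
  collinear x z -> collinear y z -> inc z l.
Proof.
move=> xy xl yl xz yz; apply: contraNT xy => zl.
by apply/eqP; apply: (collinear_point_unique zl xl yl); rewrite collinearC.
Qed.

Lemma common_neighbours_line x y l : x != y -> inc x l -> inc y l ->
  neighbours x :&: neighbours y = points_on l :\ x :\ y.
Proof.
move=> xy xl yl; apply/setP=> z; rewrite !inE.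
case: (z == x); case: (z == y); rewrite ?andbF //=.
apply/andP/idP=> [[xz yz]|zl]; first exact: no_triangle xy xl yl xz yz.
by split; apply/existsP; exists l; rewrite zl ?xl ?yl.
Qed.

(** The points [x], [y], [z] lie on one line, since there are no triangles; so do
    [y], [z], [w], and both lines contain [y] and [z]. *)
Lemma perp_of_collinear_pair x y z w : y \in neighbours x -> z \in neighbours x ->
  z \in neighbours y -> w \in neighbours y :&: neighbours z -> w \in perp x.
Proof.
move=> yx zx zy /setIP[wy wz]; rewrite perpE in_setU1; case: eqP => //= /eqP wx.
have: z \in neighbours x :&: neighbours y by rewrite in_setI zx.
move: (yx); rewrite 1!inE => /andP[ynex /existsP[l /andP[xl yl]]].
rewrite (common_neighbours_line _ xl yl) 1?eq_sym //.
rewrite !inE => /and3P[zney _ zl].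
have: w \in points_on l :\ y :\ z.
  by rewrite -(common_neighbours_line _ yl zl) 1?eq_sym // in_setI wy.
rewrite !inE => /and3P[_ _ wl]; rewrite wx /=.
by apply/existsP; exists l; rewrite xl.
Qed.

(** The lines on [x] partition the points collinear with [x], because two points
    are on at most one line. *)
Lemma card_neighbours_lines x A :
  #|neighbours x :&: A| = \sum_(l in lines_on x) #|(points_on l :&: A) :\ x|.
Proof.
under eq_bigr do rewrite -sum1_card.
rewrite (exchange_big_dep (mem (neighbours x :&: A))) /=; last first.
  move=> l y; rewrite !inE => xl /andP[-> /andP[yl ->]]; rewrite andbT /=.
  by apply/existsP; exists l; rewrite xl.
rewrite -sum1_card; apply: eq_bigr => y.
rewrite !inE => /andP[/andP[yx /existsP[l /andP[xl yl]]] yA].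
rewrite (big_pred1 l) // => l'; rewrite !inE yx yA andbT /=.
apply/andP/eqP => [[xl' yl']|->//].
by apply/esym; apply: line_unique yl xl yl' xl'.
Qed.

Lemma card_neighbours x : #|neighbours x| = s * t.+1.
Proof.
case: GQ => _ sz ln _; rewrite -[neighbours x]setIT card_neighbours_lines.
rewrite -(ln x) mulnC -sum_nat_const; apply: eq_bigr => l.
rewrite inE => xl; have := sz l; rewrite setIT (cardsD1 x) inE xl.
by case.
Qed.

Lemma card_common_collinear x y :
  y \in neighbours x -> #|neighbours x :&: neighbours y| = s.-1.
Proof.
rewrite inE => /andP[yx /existsP[l /andP[xl yl]]].
rewrite (@common_neighbours_line _ _ l) // 1?eq_sym //.
case: GQ => _ sz _ _; have := sz l.
rewrite (cardsD1 x) (cardsD1 y) !inE xl yl yx /=; lia.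
Qed.

(** Each of the [t.+1] lines on [x] misses [y] and so carries exactly one point
    collinear with [y]. *)
Lemma card_common_noncollinear x y :
  y \notin perp x -> #|neighbours x :&: neighbours y| = t.+1.
Proof.
rewrite perpE in_setU1 => /norP[yx xy].
case: GQ => _ _ ln gq; rewrite card_neighbours_lines.
rewrite -(ln x) -sum1_card; apply: eq_bigr => l.
rewrite inE => xl.
have yl: ~~ inc y l.
  apply: contra xy => yl; rewrite inE yx; apply/existsP; exists l.
  by rewrite xl.
rewrite -(gq y l yl); apply: eq_card => z; rewrite !inE.
have [->|zx] /= := eqVneq z x.
  have := xy; rewrite !inE yx /= collinearC => /negbTE->.
  by rewrite andbF.
case: (eqVneq z y) => [->|//]; by rewrite (negbTE yl).
Qed.

Lemma ovoid_neighbours x I m : ovoid m I ->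
  #|neighbours x :&: I| + (x \in I) * t.+1 = m * t.+1.
Proof.
case: GQ => _ _ ln _ oI; rewrite card_neighbours_lines -(ln x).
rewrite mulnC [RHS]mulnC -!sum_nat_const -big_split /=; apply: eq_bigr => l.
by rewrite inE => xl; rewrite -(oI l) [RHS](cardsD1 x) !inE xl addnC.
Qed.

(** The common neighbours of [z] and [x] are the other points of the line joining
    them, and that line has [m] points in [I]. *)
Lemma ovoid_common_neighbours x z I m : ovoid m I -> z \in neighbours x ->
  #|neighbours z :&: (neighbours x :&: I)| + (z \in I) + (x \in I) = m.
Proof.
move=> oI; rewrite inE => /andP[zx /existsP[l /andP[xl zl]]].
rewrite setIA (common_neighbours_line zx zl xl) -(oI l).
have := cardsD1 z (points_on l :&: I).
rewrite (cardsD1 x ((points_on l :&: I) :\ z)) !inE zl xl eq_sym zx /= => ->.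
suff -> : (points_on l :\ z :\ x) :&: I = (points_on l :&: I) :\ z :\ x by lia.
by apply/setP => w; rewrite !inE -!andbA.
Qed.

End Quadrangle.

(** * Intersection numbers and moments of the traces at infinity *)

Section Infinity.
Local Open Scope nat_scope.
Variables (G : geometry) (s t : nat).
Hypothesis GQ : generalised_quadrangle G s t.
Hypothesis s_gt0 : 0 < s.
Implicit Types (x y z : point G) (l : line G) (A B I T : {set point G}).

Lemma sum_card_second_neighbours x A :
  \sum_(z in neighbours x) #|neighbours z :&: A| =
  (x \in A) * (s * t.+1) + #|neighbours x :&: A| * s.-1 + #|A :\: perp x| * t.+1.
Proof.
rewrite sum_card_neighbours.
rewrite (@sum_by_distance _ x A _ (s * t.+1) s.-1 t.+1) //.
- by rewrite setIid (card_neighbours GQ).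
- by move=> w _ xw; rewrite setIC (card_common_collinear GQ).
- by move=> w _ xw; rewrite setIC (card_common_noncollinear GQ).
Qed.

(** The two sides count the walks of length two from [x] to [I], by their middle
    points and by their end points. *)
Lemma intriguing_walks I h1 h2 x :
    (forall y, y \in I -> #|neighbours y :&: I| = h1) ->
    (forall y, y \notin I -> #|neighbours y :&: I| = h2) ->
  #|neighbours x :&: I| * h1 + (s * t.+1 - #|neighbours x :&: I|) * h2 =
  (x \in I) * (s * t.+1) + #|neighbours x :&: I| * s.-1 + #|I :\: perp x| * t.+1.
Proof.
move=> hin hout; rewrite -sum_card_second_neighbours.
rewrite [RHS](bigID (mem I)) /=; congr (_ + _).
  rewrite -sum_nat_const; apply: eq_big => [y|y /setIP[_ /hin //]].
  by rewrite in_setI.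
rewrite -(card_neighbours GQ x) -cardsD -sum_nat_const.
apply: eq_big => [y|y /setDP[_ /hout //]].
by rewrite in_setD andbC.
Qed.

(** Comparing the walks of length two from a point of [I] with those from a point
    outside gives a quadratic equation for [h1 - h2], with roots [- t - 1] and
    [s - 1]. *)
Lemma intriguing_difference I h1 h2 : intriguing I h1 h2 ->
  h1 + t.+1 = h2 \/ h1 + 1 = h2 + s.
Proof.
case=> /set0Pn[x xI] nT hin hout.
have [y yI] := exists_notin nT.
have := intriguing_walks x hin hout; have := intriguing_walks y hin hout.
have := card_by_distance x I; have := card_by_distance y I.
have := subset_leq_card (subsetIl (neighbours x) I).
have := subset_leq_card (subsetIl (neighbours y) I).
rewrite !(card_neighbours GQ) (hin x xI) (hout y yI) xI (negbTE yI).
move=> le2 le1 c2; rewrite {}c2 !mul0n mul1n !add0n add1n => c1.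
have [p Ep] : {p | s * t.+1 = h1 + p} by exists (s * t.+1 - h1); lia.
have [q Eq] : {q | s * t.+1 = h2 + q} by exists (s * t.+1 - h2); lia.
rewrite {1}Eq addKn {1}Ep addKn => w2 w1.
have Es : s%:Z = (s.-1%:Z + 1)%R by lia.
have Et : t.+1%:Z = (t%:Z + 1)%R by lia.
move: #|_| c1 w2 => d2 c1 w2.
(* After elimination of the cardinals, the difference of [w1] and [w2] is this
   product. *)
suff: (((h1 + t.+1)%:Z - h2%:Z) * ((h1 + 1)%:Z - (h2 + s)%:Z) = 0)%R.
  by move/eqP; rewrite mulf_eq0 => /orP[] /eqP H; [left | right]; lia.
have := congr1 Posz w1; have := congr1 Posz w2; have := congr1 Posz c1.
have := congr1 Posz Eq; have := congr1 Posz Ep.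
rewrite !(PoszD, PoszM) Es Et => Hp Hq.
move=> Hc H2 H1.
have Hp2 := congr1 ( *%R h2%:Z)%R Hp; have Hq2 := congr1 ( *%R h2%:Z)%R Hq.
have Hct := congr1 ( *%R (t%:Z + 1))%R Hc.
move: Hp2 Hq2 Hct H1 H2; rewrite -(addn1 h1) PoszD; clear.
move: #|_| => d1; move: (s.-1%:Z) => s'; lra.
Qed.

Variable P : point G.
Notation affine := (~: perp P).

(** Among the neighbours of [z], the point [P] and the [s.-1] common neighbours of
    [z] and [P] are not affine. *)
Lemma card_affine_neighbours z :
  z \in neighbours P -> #|neighbours z :&: affine| = s * t.
Proof.
move=> zP; have := card_by_distance P (neighbours z).
rewrite neighboursC zP (card_common_collinear GQ zP) -setDE (card_neighbours GQ).
nia.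
Qed.

Lemma common_affine_collinear z y : z \in neighbours P -> y \in neighbours P ->
  y \in neighbours z -> #|neighbours z :&: neighbours y :&: affine| = 0.
Proof.
move=> zP yP yz; apply/eqP; rewrite cards_eq0 setIC setI_eq0; apply/pred0P => w /=.
apply/negbTE/negP => /andP[wP /(perp_of_collinear_pair GQ zP yP yz)].
by apply/negP; rewrite -in_setC.
Qed.

(** Of the [t.+1] common neighbours only [P] is lost: any other one in [perp P]
    would be on the line from [P] to [z] and on the line from [P] to [y]. *)
Lemma common_affine_noncollinear z y : z \in neighbours P -> y \in neighbours P ->
  y \notin perp z -> #|neighbours z :&: neighbours y :&: affine| = t.
Proof.
move=> zP yP yz.
have := card_by_distance P (neighbours z :&: neighbours y).
rewrite (card_common_noncollinear GQ yz) -setDE in_setI !(neighboursC _ P) zP yP.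
suff -> : neighbours P :&: (neighbours z :&: neighbours y) = set0.
  by rewrite cards0; lia.
apply/setP=> w; rewrite in_set0 !in_setI; apply/and3P => -[wP wz wy].
move/negP: yz; apply; apply: (perp_of_collinear_pair GQ (y := P) (z := w)) => //.
  by rewrite neighboursC.
by rewrite in_setI yP neighboursC.
Qed.

(** Count in two ways the collinear pairs of an affine point and a neighbour of
    [P]. *)
Lemma card_affine : #|affine| = s * s * t.
Proof.
have := sum_card_neighbours affine (neighbours P).
under [RHS]eq_bigr => z zP do rewrite (card_affine_neighbours zP).
rewrite sum_nat_const (card_neighbours GQ).
under eq_bigr => y yP.
  rewrite setIC (card_common_noncollinear GQ); last by rewrite -in_setC.
  over.
rewrite sum_nat_const; nia.
Qed.

Section Moments.
Variable T : {set point G}.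
Hypothesis T_infty : T \subset neighbours P.

Lemma affine_first_moment :
  \sum_(y in affine) #|neighbours y :&: T| = #|T| * (s * t).
Proof.
rewrite sum_card_neighbours -sum_nat_const; apply: eq_bigr => z zT.
by apply: card_affine_neighbours; apply: (subsetP T_infty).
Qed.

(** A pair of points of [T] is collinear with [s * t], [t] or no affine points
    according to whether its members are equal, noncollinear or collinear; the
    sum on the left subtracts the collinear pairs from all pairs of distinct
    points. *)
Lemma affine_second_moment :
  \sum_(y in affine) #|neighbours y :&: T| ^ 2 +
  t * \sum_(z in T) #|neighbours z :&: T| = #|T| * (s * t) + t * (#|T| * #|T|.-1).
Proof.
rewrite sum_card_neighbours_sqr big_distrr -big_split /=.
rewrite (mulnCA t) -mulnDr -sum_nat_const; apply: eq_bigr => z zT.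
have zP := subsetP T_infty z zT.
rewrite (@sum_by_distance _ z T _ (s * t) 0 t).
- rewrite zT (card_by_distance z T) zT; nia.
- by rewrite setIid (card_affine_neighbours zP).
- by move=> w wT wz; rewrite (common_affine_collinear zP) // (subsetP T_infty).
- by move=> w wT wz; rewrite (common_affine_noncollinear zP) // (subsetP T_infty).
Qed.

End Moments.

(** As [P] is not in [I], each of the [h1] neighbours in [I] of a point of [T] is
    affine or in [T]. *)
Lemma affine_moment_intriguing I h1 : P \notin I ->
    (forall y, y \in I -> #|neighbours y :&: I| = h1) ->
  let T := neighbours P :&: I in
  \sum_(y in I :\: perp P) #|neighbours y :&: T| +
  \sum_(z in T) #|neighbours z :&: T| = #|T| * h1.
Proof.
move=> PI hin T; rewrite sum_card_neighbours -big_split /= -sum_nat_const.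
apply: eq_bigr => z /setIP[zP zI]; rewrite -(hin z zI).
rewrite (card_by_distance P (neighbours z :&: I)) in_setI (negbTE PI) andbF add0n.
by rewrite addnC setIDA setICA.
Qed.

Lemma infinity_traceE A y : y \notin perp P ->
  perp y :&: A :&: perp P = neighbours y :&: (neighbours P :&: A).
Proof.
rewrite perpE in_setU1 => /norP[yneP yP]; apply/setP=> w.
rewrite (perpE y) !(in_setI, in_setU1).
have [->|_] := eqVneq w y; first by rewrite (negbTE yneP) (negbTE yP) !andbF.
have [->|_] := eqVneq w P; last by rewrite /= andbA andbAC.
by rewrite neighboursC (negbTE yP).
Qed.

Lemma affine_sum (F : point G -> nat) I :
  \sum_(y in affine) F y =
  \sum_(y in I :\: perp P) F y + \sum_(y in ~: (I :|: perp P)) F y.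
Proof.
rewrite (bigID (mem I)) /=; congr (_ + _); apply: eq_bigl => y.
  by rewrite in_setC in_setD.
by rewrite in_setC in_setC in_setU negb_or andbC.
Qed.

Lemma card_affine_split I :
  #|I :\: perp P| + #|~: (I :|: perp P)| = s * s * t.
Proof. by rewrite -card_affine -!sum1_card [RHS](affine_sum _ I). Qed.

End Infinity.

(** * Traces of tight sets and ovoids not containing the point at infinity *)

Lemma sum_sqr_deviation (T : finType) (A : {set T}) (f : T -> nat) (c : int) :
  \sum_(y in A) ((f y)%:Z - c) ^+ 2 =
  (\sum_(y in A) f y ^ 2)%N%:Z - 2 * c * (\sum_(y in A) f y)%N%:Z + c ^+ 2 * #|A|%:Z.
Proof.
rewrite -sum1_card !(big_morph Posz PoszD (erefl _)) !mulr_sumr -sumrB -big_split.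
by apply: eq_bigr => y _; rewrite -mulnn PoszM /=; ring.
Qed.

(** The moment equations of a tight set: [N1] and [N2] are the numbers of affine
    points in and outside [I], and [Q] is the number of ordered collinear pairs
    in [T].  Eliminating [Q] leaves [N1 (s^2 - a1) = N2 a2] and
    [N1 a1 (s^2 - a1) = N2 a2^2], so that [a2 (a1 - a2) = 0]. *)
Lemma tight_moment_solutions (s i N1 N2 a1 a2 Q : int) :
    s != 0 -> N1 != 0 -> N2 != 0 -> N1 = i * s -> N1 + N2 = s ^+ 4 ->
    N1 * a1 + N2 * a2 = i * s ^+ 3 ->
    N1 * a1 + Q = i * (i + s - 1) ->
    N1 * a1 ^+ 2 + N2 * a2 ^+ 2 + s ^+ 2 * Q = i * s ^+ 3 + s ^+ 2 * (i * (i - 1)) ->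
  s * a1 = i /\ s * a2 = i \/ a2 = 0.
Proof.
move=> s0 N10 N20 eN1 eN m1 mI m2.
have split1 : N1 * (s ^+ 2 - a1) = N2 * a2 by rewrite eN1 in m1 *; lra.
have split2 : N1 * a1 * (s ^+ 2 - a1) = N2 * a2 ^+ 2.
  have := congr1 ( *%R (s ^+ 2)) mI; lra.
have /eqP : N2 * a2 * (a1 - a2) = 0.
  by have := congr1 ( *%R a1) split1; lra.
rewrite !mulf_eq0 (negbTE N20) subr_eq0 /= => /orP[] /eqP e; first by right.
left; rewrite -e; suff : s * a1 = i by [].
have s3 : s ^+ 3 != 0 by rewrite expf_neq0.
apply: (mulfI s3); rewrite [RHS]mulrC -m1 -e -mulrDl eN exprSr; ring.
Qed.

Section SquareOrder.
Local Open Scope nat_scope.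
Variables (G : geometry) (s : nat).
Hypothesis s_gt1 : 2 <= s.
Hypothesis GQ : generalised_quadrangle G s (s ^ 2).
Implicit Types (x y z P : point G) (l : line G) (A B I : {set point G}).

Let s_gt0 : 0 < s. Proof. exact: ltnW. Qed.

(** The moment equations leave [a2 = 0] to be excluded.  In that case [T] avoids
    the [s^2 + 1] common neighbours of [P] and an affine point outside [I], so
    [i <= (s - 1)(s^2 + 1)]; and the [s^3] affine neighbours of a point of [T]
    are all in [I], so [s^3 <= i + s - 1].  These bounds give
    [s^2 + 2 <= 2s]. *)
Lemma tight_at_infinity I i P a1 a2 :
    tight s i I -> P \notin I -> intriguing_at_infinity (perp P) I a1 a2 ->
    I :\: perp P != set0 -> ~: (I :|: perp P) != set0 ->
  s * a1 = i /\ s * a2 = i.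
Proof.
move=> tI PI [inf1 inf2] ne1 ne2.
have hin y : y \in I -> #|neighbours y :&: I| = i + s - 1 by rewrite tI => ->.
have hout y : y \notin I -> #|neighbours y :&: I| = i by rewrite tI => /negbTE->.
pose T := neighbours P :&: I.
have cT : #|T| = i by rewrite /T hout.
have walks := intriguing_walks GQ P hin hout.
have TP : T \subset neighbours P by apply: subsetIl.
have const1 y : y \in I :\: perp P -> #|neighbours y :&: T| = a1.
  by move=> yI; rewrite -(inf1 y yI) infinity_traceE //; case/setDP: yI.
have const2 y : y \in ~: (I :|: perp P) -> #|neighbours y :&: T| = a2.
  rewrite in_setC => yI; rewrite -(inf2 y yI) infinity_traceE //.
  by apply: contra yI => yP; rewrite in_setU yP orbT.
have := affine_moment_intriguing PI hin; rewrite /= -/T cT.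
have := affine_first_moment GQ s_gt0 TP; rewrite (affine_sum _ _ I).
have := affine_second_moment GQ s_gt0 TP; rewrite (affine_sum _ _ I) cT.
rewrite !(eq_bigr (fun=> a1) const1) !(eq_bigr (fun=> a2) const2).
rewrite (eq_bigr (fun=> a1 ^ 2)); last by move=> y /const1->.
rewrite [X in _ + X + _](eq_bigr (fun=> a2 ^ 2)); last by move=> y /const2->.
rewrite !sum_nat_const. 
have := card_affine_split GQ s_gt0 P I.
rewrite -card_gt0 in ne1; rewrite -card_gt0 in ne2.
have eN1 : #|I :\: perp P| = i * s.
  apply/eqP; rewrite -(eqn_pmul2r (ltn0Sn (s ^ 2))); apply/eqP.
  move: walks; rewrite cT (negbTE PI) mul0n add0n.
  have lei : i <= s * (s ^ 2).+1.
    by rewrite -(card_neighbours GQ P) -cT subset_leq_card.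
  rewrite -(subn1 s) -addnBA // mulnDr mulnBl.
  by have := leq_mul lei (leqnn i); lia.
move=> eN m2 m1 mI.
have [] := @tight_moment_solutions s%:Z i%:Z #|I :\: perp P|%:Z
  #|~: (I :|: perp P)|%:Z a1%:Z a2%:Z (\sum_(z in T) #|neighbours z :&: T|)%:Z; try lia.
  have -> : (i%:Z - 1)%R = i.-1%:Z by case: (i) eN1 ne1 => [|i'] eN1; lia.
  lia.
case=> a20; have /set0Pn[y yA] : ~: (I :|: perp P) != set0 by rewrite -card_gt0.
have Ty : neighbours y :&: T = set0 by apply/eqP; rewrite -cards_eq0 const2 ?a20.
have yP : y \notin perp P by apply: contraL yA => yP; rewrite !inE in yP *; rewrite yP orbT.
have le1 : i + (s ^ 2).+1 <= s * (s ^ 2).+1.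
  rewrite -(card_neighbours GQ P) -{1}cT -(card_common_noncollinear GQ yP).
  rewrite addnC -[leqRHS](cardsID (neighbours y)) leq_add2l.
  apply/subset_leq_card/subsetP => z zT; rewrite in_setD (subsetP TP) // andbT.
  by apply/negP => zy; have := in_set0 z; rewrite -Ty in_setI zy zT.
have /set0Pn[z zT] : T != set0 by rewrite -card_gt0 cT; case: (i) eN1 ne1 => //; lia.
have le2 : s * s ^ 2 <= i + s - 1.
  rewrite -(card_affine_neighbours GQ s_gt0 (subsetP TP z zT)).
  rewrite -(hin z); last by case/setIP: zT.
  apply/subset_leq_card/subsetP => w; rewrite !in_setI in_setC => /andP[wz wP].
  rewrite wz /=; apply/negP => /negP wI.
  have : w \in ~: (I :|: perp P) by rewrite in_setC in_setU negb_or wI.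
  move/const2/eqP; rewrite a20 cards_eq0 => /eqP Tw.
  by have := in_set0 z; rewrite -Tw in_setI zT neighboursC wz.
by have := leq_mul s_gt1 (leqnn s); lia.
Qed.

(** The centres [m(s+1) - s] and [m(s+1)] are the trace sizes to be expected when
    [2m = s+1].  With these centres the three moments combine to an expression
    that is visibly of the sign of [2m - s - 1]. *)
Lemma ovoid_deviation I m P : ovoid m I -> P \notin I -> 0 < m ->
  let T := neighbours P :&: I in
  (\sum_(y in I :\: perp P)
      (#|neighbours y :&: T|%:Z - (m%:Z * (s%:Z + 1) - s%:Z)) ^+ 2 +
   \sum_(y in ~: (I :|: perp P))
      (#|neighbours y :&: T|%:Z - m%:Z * (s%:Z + 1)) ^+ 2 =
   s%:Z ^+ 3 * m%:Z * (2 * m%:Z - s%:Z - 1))%R.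
Proof.
move=> oI PI m_gt0 T; pose t := s ^ 2.
have hout y : y \notin I -> #|neighbours y :&: I| = m * t.+1.
  by move=> yI; rewrite -(ovoid_neighbours GQ y oI) (negbTE yI) addn0.
have hin y : y \in I -> #|neighbours y :&: I| = m.-1 * t.+1.
  move=> yI; have := ovoid_neighbours GQ y oI; rewrite yI -subn1 mulnBl; lia.
have cT : #|T| = m * t.+1 by rewrite /T hout.
have TP : T \subset neighbours P by apply: subsetIl.
have cQ : \sum_(z in T) #|neighbours z :&: T| = m * t.+1 * m.-1.
  rewrite -cT -sum_nat_const; apply: eq_bigr => z /setIP[zP zI].
  by have := ovoid_common_neighbours GQ oI zP; rewrite zI (negbTE PI) -/T; lia.
have eN1 : #|I :\: perp P| = m * (s - 1) * t.
  apply/eqP; rewrite -(eqn_pmul2r (ltn0Sn t)); apply/eqP.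
  have := intriguing_walks GQ P hin hout; rewrite -/t -/T cT (negbTE PI).
  have lem : m * t.+1 <= s * t.+1.
    by rewrite -(card_neighbours GQ P) -cT subset_leq_card.
  have [p Ep] : {p | s = m + p} by exists (s - m); rewrite leq_pmul2r // in lem; lia.
  rewrite -mulnBl Ep addKn; case: (m) m_gt0 => // m' _; rewrite addSn /= subn1 /=.
  by clearbody t; clear; move: #|_| => n; lia.
have eN := card_affine_split GQ s_gt0 P I.
have := affine_moment_intriguing PI hin; rewrite /= -/T cT cQ.
have := affine_first_moment GQ s_gt0 TP; rewrite (affine_sum _ _ I) cT.
have := affine_second_moment GQ s_gt0 TP; rewrite (affine_sum _ _ I) cT cQ.
rewrite !sum_sqr_deviation; set A1 := \sum_(y in _ ) _; set A2 := \sum_(y in _) _.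
set B1 := \sum_(y in _ ) _; set B2 := \sum_(y in _) _.
move=> m2 m1 mI.
have Em : m.-1%:Z = (m%:Z - 1)%R by lia.
have Em' : (m * t.+1).-1%:Z = (m%:Z * t.+1%:Z - 1)%R by lia.
have Et : t.+1%:Z = (s%:Z ^+ 2 + 1)%R by rewrite -addn1 PoszD /t -mulnn PoszM.
have := congr1 Posz mI; have := congr1 Posz m1; have := congr1 Posz m2.
have := congr1 Posz eN; have := congr1 Posz eN1.
have Es1 : (s - 1)%:Z = (s%:Z - 1)%R by lia.
rewrite !(PoszD, PoszM) Es1 Em Em' Et.
clearbody A1 A2 B1 B2; clear; move: #|_ :\: _| #|~: _| => n1 n2 eN1' eN' eA eB eB1.
have eN2 : n2%:Z = (s%:Z ^+ 4 - n1%:Z)%R by lra.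
have eB2 : B2%:Z = (m%:Z * (s%:Z ^+ 2 + 1) * s%:Z ^+ 3 - B1%:Z)%R by lra.
have {}eB1 : B1%:Z = (m%:Z * (s%:Z ^+ 2 + 1) * (m%:Z - 1) * s%:Z ^+ 2)%R by lra.
rewrite eN2 eB2 eB1 eN1'; lra.
Qed.

Lemma ovoid_lower_bound I m P :
  ovoid m I -> P \notin I -> 0 < m -> s.+1 <= 2 * m.
Proof.
move=> oI PI m_gt0; have := ovoid_deviation oI PI m_gt0 => /= dev.
have : (0 <= s%:Z ^+ 3 * m%:Z * (2 * m%:Z - s%:Z - 1))%R.
  by rewrite -dev addr_ge0 // sumr_ge0 // => y _; rewrite sqr_ge0.
rewrite pmulr_rge0; first by lia.
by rewrite mulr_gt0 ?exprn_gt0 //; lia.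
Qed.

Lemma ovoidC I m : ovoid m I -> ovoid (s.+1 - m) (~: I).
Proof.
by move=> oI l; case: GQ => _ sz _ _; rewrite -setDE cardsD oI sz.
Qed.

(** The lower bound holds for [I] and for its complement, and the two bounds
    meet. *)
Lemma ovoid_hemisystem I m : ovoid m I -> I != set0 -> I != setT -> 2 * m = s.+1.
Proof.
move=> oI /set0Pn[x xI] nT.
have [y yI] := exists_notin nT.
have through J k z : ovoid k J -> z \in J -> 0 < k.
  move=> oJ zJ; case: GQ => _ _ ln _.
  have /card_gt0P[l] : 0 < #|lines_on z| by rewrite ln.
  by rewrite inE -(oJ l) => zl; apply/card_gt0P; exists z; rewrite !inE zl.
have := ovoid_lower_bound oI yI (through _ _ _ oI xI).
have xC : x \notin ~: I by rewrite inE xI.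
have yC : y \in ~: I by rewrite inE.
have := ovoid_lower_bound (ovoidC oI) xC (through _ _ _ (ovoidC oI) yC).
lia.
Qed.

Lemma ovoid_at_infinity I m P a1 a2 :
    ovoid m I -> P \notin I -> intriguing_at_infinity (perp P) I a1 a2 ->
    I :\: perp P != set0 -> ~: (I :|: perp P) != set0 ->
  a1 + s = m * s.+1 /\ a2 = m * s.+1.
Proof.
move=> oI PI [inf1 inf2] /set0Pn[y1 y1I] /set0Pn[y2 y2I].
have y2I' : y2 \notin I :|: perp P by rewrite -in_setC.
have y1P : y1 \notin perp P by case/setDP: y1I.
have y2P : y2 \notin perp P by apply: contra y2I' => y2P; rewrite in_setU y2P orbT.
have I0 : I != set0 by apply/set0Pn; exists y1; case/setDP: y1I.
have IT : I != setT by apply: contraNneq PI => ->; rewrite inE.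
have half := ovoid_hemisystem oI I0 IT.
have m_gt0 : 0 < m by lia.
have := ovoid_deviation oI PI m_gt0 => /=.
have -> : (2 * m%:Z - s%:Z - 1 = 0)%R by lia.
rewrite mulr0 => /eqP; rewrite paddr_eq0; first last.
- by apply: sumr_ge0 => y _; rewrite sqr_ge0.
- by apply: sumr_ge0 => y _; rewrite sqr_ge0.
rewrite !psumr_eq0; try by move=> y _; rewrite sqr_ge0.
case/andP=> /allP/(_ y1 (mem_index_enum _)) + /allP/(_ y2 (mem_index_enum _)).
rewrite y1I y2I /= !sqrf_eq0 !subr_eq0 -!infinity_traceE //.
rewrite inf1 // inf2 // => /eqP e1 /eqP e2; split; lia.
Qed.

End SquareOrder.

(** * Intriguing sets and eigenvalues *)

Section Eigenvalue.
Variables (G : geometry) (k : nat).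
Hypothesis regular : forall x : point G, #|neighbours x| = k.

(** The characteristic vector of [I], translated by a constant, is an eigenvector:
    with [e = h1 - h2], the adjacency matrix maps chi_I to
    [e chi_I + h2 1] and maps [1] to [k 1]. *)
Lemma intriguing_eigenvalue (I : {set point G}) h1 h2 :
    intriguing I h1 h2 -> h1%:R - h2%:R != k%:R :> rat ->
  nonvalency_eigenvalue G (h1%:R - h2%:R).
Proof.
case=> /set0Pn[x xI] nT hin hout; set e : rat := _ - _ => ek.
have [y yI] := exists_notin nT.
split; last by exists k; split=> //; apply/eqP.
have dk : e - k%:R != 0 by rewrite subr_eq0.
(* This constant solves [h2 + k c = e c]. *)
pose c : rat := h2%:R / (e - k%:R).
pose v : 'rV[rat]_#|point G| := \row_i ((enum_val i \in I)%:R + c).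
apply/eigenvalueP; exists v; last first.
  apply: contraTneq isT => v0.
  have := congr1 (fun u : 'rV_#|point G| => u 0 (enum_rank x)) v0.
  have := congr1 (fun u : 'rV_#|point G| => u 0 (enum_rank y)) v0.
  by rewrite !mxE !enum_rankK xI (negbTE yI) add0r => ->; rewrite addr0 => /eqP; rewrite oner_eq0.
apply/rowP=> j; rewrite !mxE; set z := enum_val j.
transitivity (#|neighbours z :&: I|%:R + #|neighbours z|%:R * c : rat).
  transitivity (\sum_w ((w \in I)%:R + c) * (z \in neighbours w)%:R).
    rewrite (reindex (@enum_val (point G) predT)) /=; last exact/onW_bij/enum_val_bij.
    by apply: eq_bigr => i _; rewrite !mxE.
  rewrite -!sum1_card !natr_sum mulr_suml.
  rewrite [X in X + _]big_mkcond [X in _ + X]big_mkcond -big_split /=.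
  apply: eq_bigr => w _; rewrite neighboursC in_setI.
  by case: (w \in neighbours z); case: (w \in I); rewrite /=; ring.
rewrite regular; have [zI|zI] := boolP (z \in I).
  by rewrite hin // /c /=; move: dk; rewrite /e => dk; field.
by rewrite hout // /c /=; move: dk; rewrite /e => dk; field.
Qed.

End Eigenvalue.

(** * The partial quadrangle *)

Section RemovePerp.
Local Open Scope nat_scope.
Variables (G : geometry) (P : point G).
Implicit Types (x y : point (remove_perp P)) (I : {set point G}).

(** A line joining two affine points does not contain [P], so it remains a line of
    the partial quadrangle. *)
Lemma neighbours_remove_perp x y :
  (y \in neighbours x) = (val y \in neighbours (val x)).
Proof.
rewrite !inE -val_eqE; congr (_ && _).
apply/existsP/existsP => [[l /andP[xl yl]]|[l /andP[xl yl]]].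
  by exists (val l); apply/andP.
have Pl : ~~ inc P l.
  apply: contra (valP x) => Pl; rewrite !inE; apply/orP; right.
  by apply/existsP; exists l; rewrite Pl.
by exists (exist _ l Pl); apply/andP.
Qed.

Lemma card_neighbours_affine_part I x :
  #|neighbours x :&: affine_part P I| = #|neighbours (val x) :&: (I :\: perp P)|.
Proof.
rewrite -(card_imset _ val_inj); apply: eq_card => z.
apply/imsetP/idP => [[y /setIP[xy yI] ->]|].
  rewrite neighbours_remove_perp in xy; rewrite [y \in _]inE in yI.
  by rewrite in_setI in_setD xy yI (valP y).
rewrite !(in_setI, in_setD) => /and3P[zx zP zI].
exists (exist _ z zP) => //; apply/setIP; split; last by rewrite inE.
by rewrite neighbours_remove_perp.
Qed.

Lemma card_neighbours_split I w : w \notin perp P ->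
  #|neighbours w :&: I| =
  #|neighbours w :&: (neighbours P :&: I)| + #|neighbours w :&: (I :\: perp P)|.
Proof.
move=> wP; have wNP : w \notin neighbours P.
  by apply: contra wP => wP; rewrite perpE in_setU1 wP orbT.
rewrite (card_by_distance P) in_setI neighboursC (negbTE wNP) add0n.
by rewrite setIDA setICA.
Qed.

Lemma intriguing_affine_part I h1 h2 a1 a2 :
    intriguing I h1 h2 -> intriguing_at_infinity (perp P) I a1 a2 ->
    affine_part P I != set0 -> affine_part P I != setT ->
  [/\ a1 <= h1, a2 <= h2 & intriguing (affine_part P I) (h1 - a1) (h2 - a2)].
Proof.
move=> [_ _ hin hout] [inf1 inf2] n0 nT.
have in1 x : x \in affine_part P I ->
    h1 = a1 + #|neighbours x :&: affine_part P I|.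
  rewrite inE => xI; rewrite card_neighbours_affine_part -(hin _ xI).
  rewrite (card_neighbours_split I (valP x)) -infinity_traceE ?(valP x) //.
  by rewrite inf1 // in_setD xI (valP x).
have in2 x : x \notin affine_part P I ->
    h2 = a2 + #|neighbours x :&: affine_part P I|.
  rewrite inE => xI; rewrite card_neighbours_affine_part -(hout _ xI).
  rewrite (card_neighbours_split I (valP x)) -infinity_traceE ?(valP x) //.
  by rewrite inf2 // in_setU negb_or xI (valP x).
have /set0Pn[x xI] := n0.
have [y yI] := exists_notin nT.
split; first by rewrite (in1 x xI) leq_addr.
  by rewrite (in2 y yI) leq_addr.
split=> // z zI; first by rewrite {1}(in1 z zI) addKn.
by rewrite {1}(in2 z zI) addKn.
Qed.

End RemovePerp.

(** * Sets through the point at infinity, and parity *)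

Section Transfer.
Local Open Scope nat_scope.
Variables (G : geometry) (s : nat) (P : point G).
Hypothesis s_gt1 : 2 <= s.
Hypothesis GQ : generalised_quadrangle G s (s ^ 2).
Implicit Types (I : {set point G}).

Let s_gt0 : 0 < s. Proof. exact: ltnW. Qed.

Lemma affine_part_neq0 I : affine_part P I != set0 -> I :\: perp P != set0.
Proof.
case/set0Pn=> x; rewrite inE => xI; apply/set0Pn; exists (val x).
by rewrite in_setD xI (valP x).
Qed.

Lemma affine_part_neqT I :
  affine_part P I != [set: point (remove_perp P)] -> ~: (I :|: perp P) != set0.
Proof.
move=> nT.
have [x xI] := exists_notin nT.
apply/set0Pn; exists (val x); rewrite inE in xI.
by rewrite in_setC in_setU negb_or xI (valP x).
Qed.

(** The [s^2 + 1] common neighbours of [P] and an affine point are shared between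
    [I] and its complement. *)
Lemma intriguing_at_infinityC I a1 a2 :
    intriguing_at_infinity (perp P) I a1 a2 ->
    I :\: perp P != set0 -> ~: (I :|: perp P) != set0 ->
  [/\ a1 <= (s ^ 2).+1, a2 <= (s ^ 2).+1 &
  intriguing_at_infinity (perp P) (~: I) ((s ^ 2).+1 - a2) ((s ^ 2).+1 - a1)].
Proof.
move=> [inf1 inf2] /set0Pn[y1 y1I] /set0Pn[y2 y2I].
have split y : y \notin perp P ->
    #|perp y :&: I :&: perp P| + #|perp y :&: ~: I :&: perp P| = (s ^ 2).+1.
  move=> yP; rewrite !infinity_traceE // -(card_common_noncollinear GQ yP).
  by rewrite !setIA -setDE cardsID setIC.
rewrite in_setC in y2I.
have y1P : y1 \notin perp P by case/setDP: y1I.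
have y2P : y2 \notin perp P by apply: contra y2I => yP; rewrite in_setU yP orbT.
split; first by rewrite -(split _ y1P) inf1 // leq_addr.
  by rewrite -(split _ y2P) inf2 // leq_addr.
split=> y yI.
  have yP : y \notin perp P by case/setDP: yI.
  rewrite -(split _ yP) inf2 ?addKn // in_setU negb_or yP andbT.
  by case/setDP: yI; rewrite in_setC.
move: yI; rewrite in_setU in_setC negb_or negbK => /andP[yI yP].
by rewrite -(split _ yP) inf1 ?addKn // in_setD yI yP.
Qed.

(** The whole point set behaves as an [(s^3 + 1)]-tight set. *)
Lemma tightC I i : tight s i I -> I != set0 ->
  i <= (s ^ 3).+1 /\ tight s ((s ^ 3).+1 - i) (~: I).
Proof.
move=> tI /set0Pn[x xI].
have split y : #|neighbours y :&: I| + #|neighbours y :&: ~: I| = s ^ 3 + s.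
  by rewrite -setDE cardsID (card_neighbours GQ) mulnS addnC -expnS.
have le : i <= (s ^ 3).+1 by have := split x; rewrite tI xI; lia.
split=> // y; have := split y; rewrite tI inE; case: (y \in I) => /=; lia.
Qed.

Lemma card_perp_intriguing I h :
  #|neighbours P :&: I| = h -> #|I :&: perp P| = (P \in I) + h.
Proof.
move=> <-; rewrite (card_by_distance P) in_setI perpE setU11 andbT.
rewrite (_ : _ :\: _ = set0) ?cards0 ?addn0; last first.
  by apply/setP => y; rewrite in_setD in_setI in_set0 andbCA andNb andbF.
congr (_ + _); apply: eq_card => y; rewrite !(in_setI, in_setU1).
by case: (y \in neighbours P); rewrite ?orbT ?andbT.
Qed.

Lemma card_neighbours_diff_perp w :
  w \notin perp P -> #|neighbours w :\: perp P| = (s - 1) * (s ^ 2).+1.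
Proof.
move=> wP; have := card_neighbours_split setT wP.
rewrite !setIT (card_neighbours GQ) setIC (card_common_noncollinear GQ wP).
by rewrite setTD -setDE mulnBl mul1n => ->; rewrite addKn.
Qed.

Lemma card_neighbours_remove_perp (x : point (remove_perp P)) :
  #|neighbours x| = (s - 1) * (s ^ 2).+1.
Proof.
rewrite -(card_neighbours_diff_perp (valP x)) setDE -setTD.
rewrite -card_neighbours_affine_part; apply: eq_card => y.
by rewrite in_setI [y \in affine_part _ _]inE in_setT andbT.
Qed.

(** If affine points of [I] had empty traces and the others full ones, then no
    affine point of [I] would be collinear with an affine point outside [I]: the
    line joining them meets [perp P] in a point which is in both traces.  The
    affine points outside [I] would then have all their [I]-neighbours in
    [perp P], so that [h2 = s^2 + 1] and [h1 = 0], whereas an affine point of [I]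
    has affine neighbours and these would be in [I]. *)
Lemma negative_traces_not_extreme I h1 h2 :
    intriguing I h1 h2 -> h1 + (s ^ 2).+1 = h2 ->
    I :\: perp P != set0 -> ~: (I :|: perp P) != set0 ->
  ~ intriguing_at_infinity (perp P) I 0 (s ^ 2).+1.
Proof.
move=> [_ _ hin hout] eh /set0Pn[y1 y1I] /set0Pn[y2 y2I] [inf1 inf2].
have sep y z : y \in I :\: perp P -> z \in ~: (I :|: perp P) -> z \notin neighbours y.
  move=> yI zI; apply/negP; rewrite inE => /andP[zy /existsP[l /andP[yl zl]]].
  have yP : y \notin perp P by case/setDP: yI.
  have zP : z \notin perp P.
    by apply: contraL zI => zP; rewrite in_setC in_setU zP orbT.
  have Pl : ~~ inc P l.
    apply: contra yP => Pl; rewrite !inE; apply/orP; right.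
    by apply/existsP; exists l; rewrite Pl.
  have [v vl vP] := collinear_point_exists GQ Pl.
  have on w : w \notin perp P -> inc w l -> v \in neighbours w.
    move=> wP wl; rewrite inE; apply/andP; split.
      by apply: contraNneq wP => <-; rewrite perpE in_setU1 vP orbT.
    by apply/existsP; exists l; rewrite wl.
  have zT : neighbours z :&: (neighbours P :&: I) = neighbours z :&: neighbours P.
    apply/eqP; rewrite eqEcard setIA subsetIl -setIA -infinity_traceE //.
    by rewrite inf2 -?in_setC //= setIC (card_common_noncollinear GQ zP).
  have yT : neighbours y :&: (neighbours P :&: I) = set0.
    by apply/eqP; rewrite -cards_eq0 -infinity_traceE // inf1.
  have : v \in neighbours z :&: neighbours P by rewrite in_setI on.
  rewrite -zT => /setIP[_ vI]; have := in_set0 v.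
  by rewrite -yT in_setI vI on.
have y1P : y1 \notin perp P by case/setDP: y1I.
have y2P : y2 \notin perp P.
  by apply: contraL y2I => yP; rewrite in_setC in_setU yP orbT.
have := hout y2; rewrite (card_neighbours_split I y2P) -infinity_traceE // inf2 -?in_setC //.
have -> : neighbours y2 :&: (I :\: perp P) = set0.
  apply/setP=> z; rewrite in_set0 in_setI neighboursC.
  by apply/andP=> -[yz zI]; move: (sep _ _ zI y2I); rewrite yz.
rewrite cards0 addn0 => e2.
have {}e2 : h2 = (s ^ 2).+1.
  apply/esym/e2; rewrite in_setC; apply: contraL y2I => yI.
  by rewrite in_setC in_setU yI.
have h10 : h1 = 0 by lia.
have /set0Pn[w] : neighbours y1 :\: perp P != set0.
  by rewrite -card_gt0 card_neighbours_diff_perp //; nia.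
case/setDP=> wy wP; have [wI|wI] := boolP (w \in I).
  have /setDP[/hin/eqP + _] := y1I; rewrite h10 cards_eq0 => /eqP y1T.
  by have := in_set0 w; rewrite -y1T in_setI wy wI.
by move: wy; apply/negP/sep => //; rewrite in_setC in_setU negb_or wI.
Qed.

Lemma ovoid_at_infinity_through I m a1 a2 :
    ovoid m I -> P \in I -> intriguing_at_infinity (perp P) I a1 a2 ->
    I :\: perp P != set0 -> ~: (I :|: perp P) != set0 ->
  a1 + 2 * s = m * s.+1 /\ a2 + s = m * s.+1.
Proof.
move=> oI PI inf n1 n2; have [le1 le2 infC] := intriguing_at_infinityC inf n1 n2.
have PC : P \notin ~: I by rewrite inE PI.
have [||e1 e2] := ovoid_at_infinity s_gt1 GQ (ovoidC GQ oI) PC infC.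
- by rewrite setDE -setCU.
- by rewrite setCU setCK -setDE.
have half : 2 * m = s.+1.
  apply: (ovoid_hemisystem s_gt1 GQ oI); first by apply/set0Pn; exists P.
  by apply: contraNneq n2 => ->; rewrite setTU setCT.
have Em : s.+1 - m = m by lia.
have half2 : 2 * (m * s.+1) = s ^ 2 + 2 * s + 1 by rewrite mulnA half; lia.
rewrite Em in e1 e2; lia.
Qed.

Lemma tight_at_infinity_through I i a1 a2 :
    tight s i I -> P \in I -> intriguing_at_infinity (perp P) I a1 a2 ->
    I :\: perp P != set0 -> ~: (I :|: perp P) != set0 ->
  s * a1 + 1 = i + s /\ s * a2 + 1 = i + s.
Proof.
move=> tI PI inf n1 n2; have [le1 le2 infC] := intriguing_at_infinityC inf n1 n2.
have PC : P \notin ~: I by rewrite inE PI.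
have [|lei tC] := tightC tI; first by apply/set0Pn; exists P.
have [||e1 e2] := tight_at_infinity s_gt1 GQ tC PC infC.
- by rewrite setDE -setCU.
- by rewrite setCU setCK -setDE.
have Es : s ^ 3 = s * s ^ 2 by rewrite expnS.
have := leq_mul (leqnn s) le1; have := leq_mul (leqnn s) le2.
move: e1 e2; rewrite !mulnBr; lia.
Qed.

Lemma tight_at_infinity_eq I i a1 a2 :
    tight s i I -> intriguing_at_infinity (perp P) I a1 a2 ->
    I :\: perp P != set0 -> ~: (I :|: perp P) != set0 -> a1 = a2.
Proof.
move=> tI inf n1 n2; apply/eqP; rewrite -(eqn_pmul2l s_gt0); apply/eqP.
have [PI|PI] := boolP (P \in I).
  by have [e1 e2] := tight_at_infinity_through tI PI inf n1 n2; lia.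
by have [-> ->] := tight_at_infinity s_gt1 GQ tI PI inf n1 n2.
Qed.

End Transfer.

Theorem theorem5p1 (G : geometry) (s : nat) (P : point G)
    (I : {set point G}) (h1 h2 a1 a2 : nat)
    (hs : (2 <= s)%N)
    (hG : generalised_quadrangle G s (s ^ 2)%N)
    (hI : intriguing I h1 h2)
    (hinf : intriguing_at_infinity (perp P) I a1 a2)
    (hne : affine_part P I != set0)
    (hprop : affine_part P I != [set: point (remove_perp P)]) :
  (exists h1' h2' : nat, intriguing (affine_part P I) h1' h2') /\
  (positive_intriguing I -> positive_intriguing (affine_part P I)) /\
  (negative_intriguing I -> negative_intriguing (affine_part P I)) /\
  (forall m : nat, ovoid m I -> P \notin I ->
     [/\ a1%:R = m%:R * (s%:R + 1) - s%:R :> rat,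
         a2%:R = m%:R * (s%:R + 1) :> rat
       & #|I :&: perp P|%:R = m%:R * (s%:R ^+ 2 + 1) :> rat]) /\
  (forall m : nat, ovoid m I -> P \in I ->
     [/\ a1%:R = m%:R * (s%:R + 1) - 2 * s%:R :> rat,
         a2%:R = m%:R * (s%:R + 1) - s%:R :> rat
       & #|I :&: perp P|%:R = m%:R * (s%:R ^+ 2 + 1) - s%:R ^+ 2 :> rat]) /\
  (forall i : nat, tight s i I -> P \notin I ->
     [/\ a1%:R = i%:R / s%:R :> rat, a2%:R = i%:R / s%:R :> rat
       & #|I :&: perp P|%:R = i%:R :> rat]) /\
  (forall i : nat, tight s i I -> P \in I ->
     [/\ a1%:R = (i%:R - 1) / s%:R + 1 :> rat,
         a2%:R = (i%:R - 1) / s%:R + 1 :> rat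
       & #|I :&: perp P|%:R = i%:R + s%:R :> rat]).
Proof.
have s_gt0 : (0 < s)%N by apply: ltnW.
have n1 := affine_part_neq0 hne; have n2 := affine_part_neqT hprop.
have [le1 le2 _] := intriguing_at_infinityC hG hinf n1 n2.
have regular := card_neighbours_remove_perp hG (P := P).
have sr : s%:R != 0 :> rat by rewrite pnatr_eq0; lia.
have card_ovoid m : ovoid m I ->
    (#|I :&: perp P| + (P \in I) * s ^ 2 = m * (s ^ 2).+1)%N.
  by move=> oI; have := ovoid_neighbours hG P oI; rewrite (card_perp_intriguing (erefl _)); lia.
have card_tight i : tight s i I -> #|I :&: perp P| = (i + (P \in I) * s)%N.
  by move=> tI; rewrite (card_perp_intriguing (tI P)); case: (P \in I); lia.
split; [|split; [|split; [|split; [|split; [|split]]]]].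
- have [_ _ int] := intriguing_affine_part hI hinf hne hprop.
  by exists (h1 - a1)%N, (h2 - a2)%N.
- move=> [k1 [k2 [kI _ kpos]]].
  have [ek|ek] := intriguing_difference hG s_gt0 kI.
    by move: kpos; rewrite subr_ge0 ler_nat; lia.
  have [b1 b2 int] := intriguing_affine_part kI hinf hne hprop.
  have tI : tight s k2 I.
    case: kI => _ _ hin hout x; case: ifPn => [/hin->|/hout->//]; lia.
  have ea := tight_at_infinity_eq hs hG tI hinf n1 n2.
  have ed : (k1 - a1)%:R - (k2 - a2)%:R = (s - 1)%:R :> rat.
    by apply/eqP; rewrite subr_eq -natrD eqr_nat; lia.
  exists (k1 - a1)%N, (k2 - a2)%N; split=> //; last by rewrite ed ler0n.
  apply: (intriguing_eigenvalue regular int).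
  by rewrite ed eqr_nat; nia.
- move=> [k1 [k2 [kI _ kneg]]].
  have [ek|ek] := intriguing_difference hG s_gt0 kI; last first.
    by move: kneg; rewrite subr_lt0 ltr_nat; lia.
  have [b1 b2 int] := intriguing_affine_part kI hinf hne hprop.
  have ed : (k1 - a1)%:R - (k2 - a2)%:R < 0 :> rat.
    rewrite subr_lt0 ltr_nat.
    have := negative_traces_not_extreme hs hG kI ek n1 n2.
    case: (posnP a1) => [a10|]; last by lia.
    have [a2t|] := eqVneq a2 (s ^ 2).+1; last by lia.
    by move: hinf; rewrite a10 a2t => hinf' /(_ hinf').
  exists (k1 - a1)%N, (k2 - a2)%N; split=> //.
  apply: (intriguing_eigenvalue regular int).
  by apply: contraTneq ed => ->; rewrite -leNgt ler0n.
- move=> m oI PI; have := card_ovoid m oI; rewrite (negbTE PI) mul0n addn0.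
  have [e1 e2] := ovoid_at_infinity hs hG oI PI hinf n1 n2.
  by move=> ->; rewrite -natrX !natr1 -!natrM -{1}e1 -e2 natrD addrK.
- move=> m oI PI; have := card_ovoid m oI; rewrite PI mul1n => e3.
  have [e1 e2] := ovoid_at_infinity_through hs hG oI PI hinf n1 n2.
  by rewrite -natrX !natr1 -!natrM -e3 -{1}e1 -e2 !natrD !addrK.
- move=> i tI PI; rewrite (card_tight i tI) (negbTE PI) addn0.
  have [e1 e2] := tight_at_infinity hs hG tI PI hinf n1 n2.
  by split=> //; apply: (mulfI sr); rewrite mulrCA divff // mulr1 -natrM ?e1 ?e2.
- move=> i tI PI; rewrite (card_tight i tI) PI mul1n natrD.
  have [e1 e2] := tight_at_infinity_through hs hG tI PI hinf n1 n2.
  have ei a : (s * a + 1 = i + s)%N -> a%:R = (i%:R - 1) / s%:R + 1 :> rat.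
    move=> /(congr1 (fun n => n%:R : rat)); rewrite !natrD natrM => e.
    by apply: (mulfI sr); rewrite mulrDr mulrCA divff //; lra.
  by split; [exact: ei | exact: ei |].
Qed.
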